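(* Let $m\ge1$ and let $w_m$ be the unique root of $-w+(1-w)^m$ in $(0,1)$. Let $I(t)$ be the independent set produced after $t$ steps by the greedy independent set algorithm run on the uniform attachment process. Then for any $\alpha<1/3$, almost surely $$\lim_{t\to\infty}t^{\alpha}\left|\frac{|I(t)|}{t}-w_m\right|=0.$$
   Context: Uniform attachment process (integer $m\ge1$): start with the single vertex $1$; for each $t\ge1$, vertex $t+1$ selects $m$ vertices from $[t]$ independently and uniformly at random (repetitions allowed) and is joined by an edge to each selected vertex. Greedy independent set algorithm: $I(1)=\{1\}$; $I(t+1)=I(t)\cup\{t+1\}$ if vertex $t+1$ selects no vertex of $I(t)$, and $I(t+1)=I(t)$ otherwise. *)

(* Defs.v *)
From HB Require Import structures.
From mathcomp Require Import all_boot all_order all_algebra finmap.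
From mathcomp Require Import all_classical all_reals all_analysis.

Set Implicit Arguments.
Unset Strict Implicit.
Unset Printing Implicit Defensive.

Import Order.TTheory GRing.Theory Num.Theory.
Import numFieldNormedType.Exports.

Local Open Scope classical_set_scope.
Local Open Scope ring_scope.

(* Mutual independence of the subfamily (X i), i in D: the product rule on
   every finite set of indices of D. *)
Definition mutually_independent (R : realType)
    (d : measure_display) (T : measurableType d) (P : probability T R)
    (d' : measure_display) (T' : measurableType d')
    (I : choiceType) (D : set I) (X : I -> {RV P >-> T'}) : Prop :=
  forall (J : {fset I}) (B : I -> set T'),
    (forall i, i \in J -> D i) ->
    (forall i, i \in J -> measurable (B i)) ->
    P (\bigcap_(i in [set` J]) (X i @^-1` B i)) =
    (\prod_(i <- J) P (X i @^-1` B i))%E.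

(* [sel v j] is the j-th vertex selected by vertex v. Vertices are numbered
   from 1 and only v >= 2 selects; the values of [sel] at v = 0, 1 are
   unconstrained and never used. *)
Definition uniform_attachment (R : realType)
    (d : measure_display) (T : measurableType d) (P : probability T R)
    (m : nat) (sel : nat -> 'I_m -> {RV P >-> nat}) : Prop :=
  (forall t (j : 'I_m) k, (1 <= t)%N -> (1 <= k <= t)%N ->
     P (sel t.+1 j @^-1` [set k]) = (t%:R^-1)%:E) /\
  mutually_independent [set i : nat * 'I_m | (2 <= i.1)%N]
    (fun i => sel i.1 i.2).

(* I(t) for one realization [s] of the selections; I(0) is a dummy value. *)
Fixpoint greedy_indep (m : nat) (s : nat -> 'I_m -> nat) (t : nat)
    : {fset nat} :=
  match t with
  | 0 => fset0
  | 1 => [fset 1%N]%fset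
  | (_.+1 as u).+1 =>
      if [forall j, s u.+1 j \notin greedy_indep s u]
      then (u.+1 |` greedy_indep s u)%fset
      else greedy_indep s u
  end.

(* Main.v *)
Require Import Defs.
From HB Require Import structures.
From mathcomp Require Import all_boot all_order all_algebra finmap.
From mathcomp Require Import all_classical all_reals all_analysis.
From mathcomp Require Import ring lra.

Set Implicit Arguments.
Unset Strict Implicit.

Import Order.TTheory GRing.Theory Num.Theory.
Import numFieldNormedType.Exports.

Local Open Scope classical_set_scope.
Local Open Scope ring_scope.

(* Write [X t = #|I(t)|] and [Y t = X t - w t]. Given I(t), vertex t + 1 joins with
   probability [(1 - X t / t) ^+ m], which is decreasing in [X t] and equals [w] at
   [X t = w t]; hence the drift of [Y] opposes [Y], and [E (Y t ^+ 2) <= t]. With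
   [delta = 1 - 3 alpha > 0], Chebyshev gives
   [P (K `^ (2 + delta / 2) < |Y (K ^ 3)|) <= K `^ (- (1 + delta))], which is
   summable, so Borel-Cantelli controls [Y] along the cubes. Between consecutive
   cubes [Y] moves by [O(K ^ 2)], because its increments are bounded by 1. *)

(** * The limit [w] and estimates on negative powers *)

(** [x - (1 - x) ^+ m] runs from -1 to 1 on the unit interval, so it vanishes somewhere; a second
    root would contradict that [(1 - x) ^+ m] is nonincreasing there. *)
Lemma fixpoint_decreasing_power (R : realType) (m : nat) : (1 <= m)%N ->
  exists w : R, unique (fun x : R => 0 < x < 1 /\ - x + (1 - x) ^+ m = 0) w.
Proof.
move=> m1; pose p : {poly R} := 'X - (1 - 'X) ^+ m.
have pE x : p.[x] = x - (1 - x) ^+ m by rewrite /p !hornerE.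
have [|w /andP[w0 w1] /rootP] := @poly_ivt R p 0 1 ler01.
  rewrite !pE subr0 subrr expr1n expr0n (gtn_eqF m1)/=; lra.
rewrite pE => wE; exists w; split; first split.
- rewrite !lt_neqAle w0 w1 !andbT; apply/andP; split; apply/eqP => e.
    by move: wE; rewrite -e subr0 expr1n; lra.
  by move: wE; rewrite e subrr expr0n (gtn_eqF m1)/=; lra.
- lra.
- move=> y [/andP[y0 y1] yE]; apply/eqP; rewrite eq_le; apply/andP; split.
    rewrite leNgt; apply/negP => yw.
    have : (1 - w) ^+ m <= (1 - y) ^+ m by rewrite lerXn2r ?nnegrE; lra.
    lra.
  rewrite leNgt; apply/negP => yw.
  have : (1 - y) ^+ m <= (1 - w) ^+ m by rewrite lerXn2r ?nnegrE; lra.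
  lra.
Qed.

(** A discrete comparison of a sum with an integral. For [x = n + 1] and [y = n + 2], the bounds
    [ln (1 + z) <= z] and [1 + z <= expR z] give [1 + a / y] as a lower bound for the power [- a] of
    [x / y = 1 - y^-1]. *)
Lemma powRN_telescope (R : realType) (a : R) (n : nat) : 0 < a ->
  a * n.+2%:R `^ (- (1 + a)) <= n.+1%:R `^ (- a) - n.+2%:R `^ (- a).
Proof.
move=> a0; set x : R := n.+1%:R; set y : R := n.+2%:R.
have x0 : 0 < x by rewrite ltr0n.
have y0 : 0 < y by rewrite ltr0n.
have yx : y = x + 1 by rewrite /y -natr1.
have -> : x `^ (- a) = y `^ (- a) * (x / y) `^ (- a).
  by rewrite -powRM ?divr_ge0 ?ltW// mulrCA mulfV ?gt_eqF// mulr1.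
have -> : y `^ (- (1 + a)) = y `^ (- a) * y^-1.
  rewrite opprD addrC powRD ?(gt_eqF y0) ?implybT//.
  by rewrite powR_inv1 ?ltW.
have h : 1 + a / y <= (x / y) `^ (- a).
  rewrite /powR gt_eqF ?divr_gt0//; apply: le_trans (expR_ge1Dx _).
  rewrite lerD2l mulNr -mulrN ler_pM2l// lerNr.
  have -> : x / y = 1 + - y^-1 by rewrite yx; field; apply: lt0r_neq0; lra.
  by apply: le_ln1Dx; rewrite ltrN2 invf_lt1// yx ltrDr.
have p0 : 0 < y `^ (- a) by apply: powR_gt0.
by rewrite mulrCA -{3}[y `^ (- a)]mulr1 -mulrBr ler_pM2l//; rewrite lerBrDl.
Qed.

Lemma sum_powRN_le (R : realType) (a : R) (n : nat) : 0 < a ->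
  \sum_(0 <= k < n) k.+1%:R `^ (- (1 + a)) <= 1 + a^-1.
Proof.
move=> a0; have ai : 0 < a^-1 by rewrite invr_gt0.
case: n => [|n]; first by rewrite big_geq//; lra.
(* The sharper bound keeps the telescoped remainder, which pays for the next summand in the
   induction. *)
suff : \sum_(0 <= k < n.+1) k.+1%:R `^ (- (1 + a)) <=
    1 + a^-1 * (1 - n.+1%:R `^ (- a)).
  by move/le_trans; apply; rewrite lerD2l -[leRHS]mulr1 ler_pM2l// gerBl powR_ge0.
elim: n => [|n IH]; first by rewrite big_nat1 !powR1 subrr mulr0 addr0.
rewrite big_nat_recr//=; have := powRN_telescope n a0.
rewrite -(ler_pM2l ai) mulrA mulVf ?gt_eqF// mul1r.
by move: IH; rewrite !mulrBr; lra.
Qed.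

Lemma powRN_eventually_lt (R : realType) (a : R) : 0 < a ->
  forall e : R, 0 < e -> exists N : nat, forall k : nat, (N <= k)%N ->
    k.+1%:R `^ (- a) < e.
Proof.
move=> a0 e e0; exists (Num.truncn (e `^ (- a^-1))) => k Nk.
have lt1 : e `^ (- a^-1) < k.+1%:R.
  apply: lt_le_trans (truncnS_gt _) _.
  by rewrite ler_nat.
have : (e `^ (- a^-1)) `^ a < k.+1%:R `^ a.
  by apply: gt0_ltr_powR => //; rewrite nnegrE ?powR_ge0.
rewrite -powRrM mulNr mulVf ?gt_eqF// powR_inv1 ?ltW// => h.
by rewrite powRN -[ltRHS]invrK ltf_pV2// ?posrE ?invr_gt0 ?powR_gt0 ?ltr0n//.
Qed.

(** * Interpolation between consecutive cubes *)

Lemma cube_bracket (t N : nat) : (N.+1 ^ 3 <= t)%N ->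
  exists2 k, (N <= k)%N & (k.+1 ^ 3 <= t < k.+2 ^ 3)%N.
Proof.
move=> Nt; have ex : exists k, (k.+1 ^ 3 <= t)%N by exists N.
have ub k : (k.+1 ^ 3 <= t)%N -> (k <= t)%N.
  move=> h; apply: leq_trans h; apply: leq_trans (leqnSn k) _.
  by rewrite -{1}[k.+1]expn1 leq_pexp2l.
case: (ex_maxnP ex ub) => k kt kmax; exists k; first exact: kmax.
by rewrite kt /= ltnNge; apply/negP => /kmax; rewrite ltnn.
Qed.

Lemma lipschitz_nat (R : realType) (Y : nat -> R) :
  (forall t, (1 <= t)%N -> `|Y t.+1 - Y t| <= 1) ->
  forall s t, (1 <= s)%N -> (s <= t)%N -> `|Y t - Y s| <= t%:R - s%:R.
Proof.
move=> Y1 s t s1; elim: t => [|t IH].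
  by rewrite leqn0 => /eqP ->; rewrite !subrr normr0.
rewrite leq_eqVlt => /predU1P[->|st]; first by rewrite !subrr normr0.
rewrite (_ : _ - _ = (Y t.+1 - Y t) + (Y t - Y s)); last by ring.
apply: le_trans (ler_normD _ _) _; rewrite -natr1.
have := Y1 _ (leq_trans s1 st); have := IH st; lra.
Qed.

(* Consecutive cubes around [t] differ by [O(K ^ 2)], which is [o(t `^ (1 - alpha))]
   precisely when [alpha < 1 / 3]. *)
Lemma cube_interpolation (R : realType) (Y : nat -> R) (alpha : R) (N : nat) :
  alpha < 1 / 3 ->
  (forall t, (1 <= t)%N -> `|Y t.+1 - Y t| <= 1) ->
  (forall k, (N <= k)%N ->
     `|Y (k.+1 ^ 3)%N| <= k.+1%:R `^ (2 + (1 - 3 * alpha) / 2)) ->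
  (fun t : nat => t%:R `^ alpha * (`|Y t| / t%:R)) @ \oo --> (0 : R).
Proof.
move=> a3 Y1 YN; set del := 1 - 3 * alpha.
have d0 : 0 < del / 2 by rewrite /del; lra.
apply/cvgrPdist_lt => e e0.
(* The final bound is eight times the power [- (del / 2)] of [K]: one from the deviation at the
   cube, seven from the gap to the next cube. *)
have e8 : 0 < e / 8 by rewrite divr_gt0.
have [M hM] := powRN_eventually_lt d0 e8.
exists ((maxn M N).+1 ^ 3)%N => // t /= /cube_bracket[k].
rewrite geq_max => /andP[Mk Nk] /andP[kt tk].
have t0 : (0 < t)%N by apply: leq_trans kt; rewrite expn_gt0.
have tR : (0 : R) < t%:R by rewrite ltr0n.
rewrite sub0r normrN ger0_norm ?mulr_ge0 ?powR_ge0 ?invr_ge0 ?ler0n//.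
have := hM _ Mk; set K : R := k.+1%:R => KM.
have K1 : 1 <= K by rewrite ler1n.
have K0 : 0 < K by rewrite ltr0n.
(* [(K + 1) ^+ 3 - K ^+ 3 = 3 * K ^+ 2 + 3 * K + 1] is at most [7 * K ^+ 2] because [1 <= K]. *)
have Yt : `|Y t| <= K `^ (2 + del / 2) + 7 * K ^+ 2.
  have : `|Y t - Y (k.+1 ^ 3)%N| <= t%:R - (k.+1 ^ 3)%:R.
    by apply: lipschitz_nat => //; rewrite expn_gt0.
  have : t%:R <= (k.+2 ^ 3)%:R :> R by rewrite ler_nat ltnW.
  have := YN _ Nk; rewrite -/K -/del.
  rewrite !natrX -/K -[k.+2%:R]natr1 -/K.
  have := ler_normD (Y t - Y (k.+1 ^ 3)%N) (Y (k.+1 ^ 3)%N); rewrite subrK.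
  have -> : (K + 1) ^+ 3 = K ^+ 3 + 3 * K ^+ 2 + 3 * K + 1 by ring.
  have : K <= K ^+ 2 by rewrite expr2 ler_peMr// ltW.
  lra.
rewrite mulrCA; set c := (X in _ * X).
have cE : c = t%:R `^ (- (1 - alpha)).
  rewrite /c opprB powRD ?(gt_eqF tR) ?implybT//.
  by rewrite powR_inv1 ?ltW.
(* Here [K ^+ 3 <= t] and [3 * (1 - alpha) = 2 + del]. *)
have c_le : c <= K `^ (- (2 + del)).
  have -> : K `^ (- (2 + del)) = (K ^+ 3) `^ (- (1 - alpha)).
    rewrite -powR_mulrn ?ltW// -powRrM; congr (_ `^ _); rewrite /del.
    lra.
  rewrite cE !powRN lef_pV2 ?posrE ?powR_gt0 ?exprn_gt0//.
  apply: ge0_ler_powR; rewrite ?nnegrE ?exprn_ge0 ?ler0n//; first lra.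
  by rewrite -natrX ler_nat.
have c0 : 0 <= c by rewrite cE powR_ge0.
apply: (@le_lt_trans _ _ ((K `^ (2 + del / 2) + 7 * K ^+ 2) * K `^ (- (2 + del)))).
  by apply: ler_pM.
have -> : K ^+ 2 = K `^ 2 by rewrite powR_mulrn ?ltW.
rewrite mulrDl -mulrA -!powRD ?(gt_eqF K0) ?implybT//.
have -> : 2 + del / 2 - (2 + del) = - (del / 2) by lra.
have -> : 2 - (2 + del) = - del by lra.
have : K `^ (- del) <= K `^ (- (del / 2)).
  by apply: ler_powR => //; lra.
lra.
Qed.

(** * Possible values and one-step dynamics of the greedy set *)

(* Contains every possible value of I(u + 1). *)
Fixpoint greedy_values (u : nat) : seq {fset nat} :=
  if u is u'.+1 then
    greedy_values u' ++ [seq (u'.+2 |` G)%fset | G <- greedy_values u']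
  else [:: [fset 1%N]%fset].

Lemma greedy_values_range u G k :
  G \in greedy_values u -> k \in G -> (1 <= k <= u.+1)%N.
Proof.
elim: u G => [|u IH] G /=; first by rewrite inE => /eqP ->; rewrite inE => /eqP ->.
rewrite mem_cat => /orP[GL kS|/mapP[G' GL ->]].
  by have /andP[-> /leqW ->] := IH _ GL kS.
by rewrite !inE => /predU1P[->|/(IH _ GL)/andP[-> /leqW ->]] //=.
Qed.

Lemma greedy_values_fresh u G : G \in greedy_values u -> u.+2 \notin G.
Proof.
by move=> GL; apply/negP => /(greedy_values_range GL); rewrite ltnn andbF.
Qed.

Lemma greedy_values_card u G : G \in greedy_values u -> (#|` G| <= u.+1)%N.
Proof.
elim: u G => [|u IH] G /=; first by rewrite inE => /eqP ->; rewrite cardfs1.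
rewrite mem_cat => /orP[/IH/leqW //|/mapP[G' GL ->]].
by rewrite cardfsU1 (greedy_values_fresh GL) add1n ltnS IH.
Qed.

Section greedy_step.
Variables (m : nat) (s : nat -> 'I_m -> nat).

Lemma greedy_indepSS u : greedy_indep s u.+2 =
  if [forall j, s u.+2 j \notin greedy_indep s u.+1]
  then (u.+2 |` greedy_indep s u.+1)%fset else greedy_indep s u.+1.
Proof. by []. Qed.

Lemma mem_greedy_values u : greedy_indep s u.+1 \in greedy_values u.
Proof.
elim: u => [|u IH]; first by rewrite inE.
rewrite greedy_indepSS mem_cat; case: ifP => _; last by rewrite IH.
by rewrite (map_f _ IH) orbT.
Qed.

Lemma card_greedySS u : #|` greedy_indep s u.+2| =
  ([forall j, s u.+2 j \notin greedy_indep s u.+1] + #|` greedy_indep s u.+1|)%N.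
Proof.
rewrite greedy_indepSS; case: ifP => _ //.
by rewrite cardfsU1 (greedy_values_fresh (mem_greedy_values u)).
Qed.

(** The increment is the indicator that vertex [t + 1] joins, minus [w]. *)
Lemma greedy_dist_lipschitz (R : realType) (w : R) t : 0 < w < 1 -> (1 <= t)%N ->
  `|(#|` greedy_indep s t.+1|%:R - w * t.+1%:R) -
    (#|` greedy_indep s t|%:R - w * t%:R)| <= 1.
Proof.
move=> w01; case: t => // u _; rewrite card_greedySS natrD -[u.+2%:R]natr1.
have : 0 <= ([forall j, s u.+2 j \notin greedy_indep s u.+1]%:R : R) <= 1.
  by case: [forall j, _]; rewrite ?lexx ?ler01.
move: (_%:R : R) (_%:R : R) (_%:R : R) => x y z hx.
by rewrite ler_norml; lra.
Qed.

(** Vertex [u.+2] lies in no possible value of I(u + 1), so the new set reveals which branch was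
    taken. This and [greedy_grow] reduce events about I(u + 2) to I(u + 1) and the selections of
    [u.+2]. *)
Lemma greedy_stay u G : G \in greedy_values u ->
  (greedy_indep s u.+2 = G) <->
  (greedy_indep s u.+1 = G /\ ~ (forall j, s u.+2 j \notin G)).
Proof.
move=> GL; rewrite greedy_indepSS; case: ifPn => [/forallP h|/forallP h].
- split=> [e|[e []//]]; last by rewrite -e.
  by have := greedy_values_fresh GL; rewrite -e !inE eqxx.
- by split=> [e|[]//]; split=> //; rewrite -e.
Qed.

Lemma greedy_grow u G : G \in greedy_values u ->
  (greedy_indep s u.+2 = u.+2 |` G)%fset <->
  (greedy_indep s u.+1 = G /\ (forall j, s u.+2 j \notin G)).
Proof.
move=> GL; have fr := greedy_values_fresh (mem_greedy_values u).
rewrite greedy_indepSS; case: ifPn => [/forallP h|/forallP h]; split.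
- move=> e; suff eS : greedy_indep s u.+1 = G by rewrite -eS.
  by rewrite -(fsetU1K fr) e fsetU1K// greedy_values_fresh.
- by move=> [-> _].
- by move=> e; move: fr; rewrite e !inE eqxx.
- by move=> [e hS]; exfalso; apply: h; rewrite e.
Qed.

End greedy_step.

(** * Law of the greedy set and independence from later selections *)

Section greedy_law.
Context (R : realType) (m : nat) (d : measure_display) (T : measurableType d).
Context (P : probability T R) (sel : nat -> 'I_m -> {RV P >-> nat}).

Local Notation pr A := (fine (P A)).

Definition greedy_event u (G : {fset nat}) : set T :=
  [set x | greedy_indep (fun v j => sel v j x) u.+1 = G].

Definition select_in v (B : set nat) : set T := [set x | forall j, B (sel v j x)].

(** Rectangle events: for [1 <= u], these are events to which the product rule of
    [mutually_independent] applies. *)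
Definition select_from u n (B : nat -> set nat) : set T :=
  [set x | forall v, (u < v <= n)%N -> select_in v (B v) x].

Lemma fine_probability A : measurable A -> P A = (pr A)%:E.
Proof. by move=> mA; rewrite fineK// fin_num_measure. Qed.

Lemma fine_probabilityD A B : measurable A -> measurable B ->
  pr (A `\` B) = pr A - pr (A `&` B).
Proof.
move=> mA mB; have PA := fin_num_measure P _ mA.
rewrite measureD//; last by rewrite ltey_eq PA.
by rewrite fineB// fin_num_measure//; apply: measurableI.
Qed.

Lemma measurable_select_in v B : measurable (select_in v B).
Proof.
rewrite (_ : select_in v B = \bigcap_(j in setT) (sel v j @^-1` B)).
  apply: fin_bigcap_measurable; first exact: finite_finset.
  by move=> j _; exact: measurable_funPTI.
by apply/seteqP; split=> x h j; [move=> _|]; apply: h.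
Qed.

Lemma measurable_select_from u n B : measurable (select_from u n B).
Proof.
rewrite (_ : select_from u n B =
    \bigcap_(v in [set v | (u < v <= n)%N]) select_in v (B v)) //.
apply: bigcap_measurableType => v _; exact: measurable_select_in.
Qed.

Lemma greedy_event_stay u G : G \in greedy_values u ->
  greedy_event u.+1 G = greedy_event u G `\` select_in u.+2 (~` [set` G]).
Proof.
move=> GL; apply/seteqP; split=> x /=.
  move=> /(greedy_stay _ GL)[e h]; split=> // h'; apply: h => j.
  by apply/negP; apply: h'.
move=> [e h]; apply/(greedy_stay _ GL); split=> // h'; apply: h => j.
exact/negP/h'.
Qed.

Lemma greedy_event_grow u G : G \in greedy_values u ->
  greedy_event u.+1 (u.+2 |` G)%fset =
  greedy_event u G `&` select_in u.+2 (~` [set` G]).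
Proof.
move=> GL; apply/seteqP; split=> x /=.
  by move=> /(greedy_grow _ GL)[e h]; split=> // j; apply/negP/h.
by move=> [e h]; apply/(greedy_grow _ GL); split=> // j; apply/negP/h.
Qed.

Lemma measurable_greedy_event u G : G \in greedy_values u ->
  measurable (greedy_event u G).
Proof.
elim: u G => [|u IH] G /=.
  rewrite inE => /eqP ->; rewrite (_ : greedy_event _ _ = setT)//.
  by apply/seteqP; split.
rewrite mem_cat => /orP[GL|/mapP[G' GL ->]].
  rewrite greedy_event_stay//; apply: measurableD; first exact: IH.
  exact: measurable_select_in.
rewrite greedy_event_grow//; apply: measurableI; first exact: IH.
exact: measurable_select_in.
Qed.

Hypothesis hsel : uniform_attachment sel.

(** For [2 <= v], the value that independence gives to the probability of [select_in v B]. *)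
Let b v (B : set nat) := \prod_(j < m) pr (sel v j @^-1` B).

Lemma probability_select_from n (B : nat -> set nat) :
  pr (select_from 1 n B) = \prod_(2 <= v < n.+1) b v (B v).
Proof.
have [_ ind] := hsel.
(* Listing the index pairs vertex by vertex lets the product over [J] split into a double
   product. *)
pose s := [seq (v, j) | v <- index_iota 2 n.+1, j <- enum 'I_m].
pose J := [fset i in s]%fset.
have JE i : (i \in J) = (1 < i.1 <= n)%N.
  rewrite !inE; case: i => v j /=.
  apply/allpairsP/idP => [[[v' j'] /= [+ _ [-> _]]]|h].
    by rewrite mem_index_iota.
  by exists (v, j); split; rewrite ?mem_index_iota ?mem_enum.
have -> : select_from 1 n B = \bigcap_(i in [set` J]) (sel i.1 i.2 @^-1` B i.1).
  apply/seteqP; split=> x /= h.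
    by move=> [v j]; rewrite /= JE => vn; apply: h.
  by move=> v vn j; apply: (h (v, j)); rewrite /= JE.
have hJ i : i \in J -> [set i : nat * 'I_m | (2 <= i.1)%N] i.
  by rewrite JE => /andP[].
rewrite (ind J (fun i => B i.1) hJ)//.
rewrite (eq_bigr (fun i => (pr (sel i.1 i.2 @^-1` B i.1))%:E)); last first.
  by move=> i _; rewrite -fine_probability//; exact: measurable_funPTI.
rewrite prodEFin /=; have us : uniq s.
  by rewrite allpairs_uniq ?iota_uniq ?enum_uniq// => -[? ?] [? ?].
rewrite (perm_big s) /=; last first.
  by apply: uniq_perm; rewrite ?fset_uniq// => i; rewrite !inE.
rewrite big_allpairs_dep; apply: eq_bigr => v _.
by rewrite big_enum.
Qed.

(** Independence of I(u + 1) from later selections, by induction on [u]: a greedy event at [u.+1] is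
    one at [u] intersected with, or minus, a condition on vertex [u.+2], and that condition merges
    into a rectangle starting one vertex earlier. *)
Lemma greedy_event_select_from u n G (B : nat -> set nat) :
  G \in greedy_values u -> (u < n)%N ->
  pr (greedy_event u G `&` select_from u.+1 n B) =
  pr (greedy_event u G) * \prod_(u.+2 <= v < n.+1) b v (B v).
Proof.
elim: u n G B => [|u IH] n G B.
  rewrite inE => /eqP -> _.
  rewrite (_ : greedy_event _ _ = setT); last by apply/seteqP; split.
  by rewrite setTI probability_setT mul1r probability_select_from.
have step n' G' C : G' \in greedy_values u -> (u.+1 < n')%N ->
    pr (greedy_event u G' `&` select_in u.+2 C `&` select_from u.+2 n' B) =
    pr (greedy_event u G') * b u.+2 C * \prod_(u.+3 <= v < n'.+1) b v (B v).
  move=> GL un; pose B' v := if v == u.+2 then C else B v.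
  rewrite -setIA (_ : select_in _ _ `&` _ = select_from u.+1 n' B').
    rewrite IH//; last exact: ltnW.
    rewrite big_ltn ?ltnS// /B' eqxx mulrA; congr (_ * _).
    by apply: eq_big_nat => v /andP[uv _]; rewrite gtn_eqF.
  apply/seteqP; split=> x /=.
    move=> [hC h] v /andP[uv vn]; rewrite /B'; case: eqVneq => [->//|nv].
    by apply: h; rewrite vn andbT ltn_neqAle eq_sym nv.
  move=> h; split=> [|v /andP[uv vn]].
    by have := h u.+2; rewrite /B' eqxx; apply; rewrite ltnSn.
  by have := h v; rewrite /B' gtn_eqF//; apply; rewrite vn andbT ltnW.
(* Two extreme cases of [step]: [C = setT] frees vertex [u.+2], and in [step1] the choice
   [n' = u.+2] leaves no later vertex. *)
have stepT n' G' : G' \in greedy_values u -> (u.+1 < n')%N ->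
    pr (greedy_event u G' `&` select_from u.+2 n' B) =
    pr (greedy_event u G') * \prod_(u.+3 <= v < n'.+1) b v (B v).
  move=> GL un; have := step n' G' setT GL un.
  rewrite (_ : select_in _ _ = setT) ?setIT; last by apply/seteqP; split.
  rewrite {1}/b big1 ?mulr1// => j _.
  by rewrite preimage_setT probability_setT.
have step1 G' C : G' \in greedy_values u ->
    pr (greedy_event u G' `&` select_in u.+2 C) = pr (greedy_event u G') * b u.+2 C.
  move=> GL; have := step u.+2 G' C GL (ltnSn _).
  rewrite (_ : select_from _ _ _ = setT) ?setIT ?big_geq ?mulr1//.
  apply/seteqP; split=> // x _ v /andP[uv vu].
  by have := leq_trans uv vu; rewrite ltnn.
rewrite [in X in X -> _]/= mem_cat => /orP[GL|/mapP[G' GL ->]] un; last first.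
  by rewrite greedy_event_grow// step// step1.
have mA := measurable_greedy_event GL.
have mE := measurable_select_in u.+2 (~` [set` G]).
have mC := measurable_select_from u.+2 n B.
(* The staying event is a difference, so its probability comes from subtracting [step] from
   [stepT]. *)
rewrite greedy_event_stay// fine_probabilityD// setDE setIAC -setDE.
rewrite fine_probabilityD//; last exact: measurableI.
by rewrite setIAC step// step1// stepT// mulrBl.
Qed.

Lemma greedy_event_select u G C : G \in greedy_values u ->
  pr (greedy_event u G `&` select_in u.+2 C) = pr (greedy_event u G) * b u.+2 C.
Proof.
move=> GL; have := greedy_event_select_from (fun=> C) GL (ltnW (ltnSn u.+1)).
rewrite big_nat1 => <-; congr (pr (_ `&` _)).
apply/seteqP; split=> x /=.
  by move=> h v /andP[uv vu]; rewrite (_ : v = u.+2)//; apply/eqP; rewrite eqn_leq vu.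
by apply; rewrite ltnSn /=.
Qed.

Lemma probability_sel_in u j (s : seq nat) : uniq s ->
  (forall k, k \in s -> (1 <= k <= u.+1)%N) ->
  pr (sel u.+2 j @^-1` [set` s]) = (size s)%:R / u.+1%:R.
Proof.
have [unif _] := hsel.
elim: s => [|k s IH] /=.
  move=> _ _; rewrite (_ : _ @^-1` _ = set0) ?measure0 ?mul0r//.
  by apply/seteqP; split.
move=> /andP[ks us] h.
rewrite (_ : _ @^-1` _ = (sel u.+2 j @^-1` [set k]) `|` (sel u.+2 j @^-1` [set` s])).
  rewrite measureU//; [|exact: measurable_funPTI..|].
    rewrite fineD ?fin_num_measure//; [|exact: measurable_funPTI..].
    have pk : pr (sel u.+2 j @^-1` [set k]) = u.+1%:R^-1.
      by rewrite unif ?h ?mem_head.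
    have ps : pr (sel u.+2 j @^-1` [set` s]) = (size s)%:R / u.+1%:R.
      by apply: IH => // i si; apply: h; rewrite inE si orbT.
    by rewrite [X in X + _]pk [X in _ + X]ps -[(size s).+1%:R]nat1r mulrDl mul1r.
  apply/seteqP; split=> // x [/= e]; rewrite e => ks'.
  by rewrite ks' in ks.
apply/seteqP; split=> x /=; rewrite inE.
  by move=> /predU1P[->|]; [left|right].
by move=> [->|->]; rewrite ?eqxx ?orbT.
Qed.

(** [G] lies in [1, u + 1], where every point has mass [u.+1%:R^-1] for each selection of [u.+2];
    taking complements gives the [m] equal factors. *)
Lemma probability_avoid u G : G \in greedy_values u ->
  b u.+2 (~` [set` G]) = (1 - #|` G|%:R / u.+1%:R) ^+ m.
Proof.
move=> GL; rewrite /b (eq_bigr (fun=> 1 - #|` G|%:R / u.+1%:R)) => [|j _].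
  by rewrite prodr_const card_ord.
have mG : measurable (sel u.+2 j @^-1` [set` G]) by exact: measurable_funPTI.
rewrite (_ : _ @^-1` _ = setT `\` (sel u.+2 j @^-1` [set` G])); last by rewrite setTD.
rewrite fine_probabilityD// setTI probability_setT.
congr (_ - _); apply: probability_sel_in; first exact: fset_uniq.
by move=> k; exact: greedy_values_range.
Qed.

(** * Moments of the greedy set *)

(** The expectation of [f] at I(u + 1), as a finite sum in place of an integral. *)
Definition greedy_mean u (f : {fset nat} -> R) : R :=
  \sum_(G <- greedy_values u) pr (greedy_event u G) * f G.

(** The Markov property: given I(u + 1) = [G], vertex [u.+2] joins with probability [q]. *)
Lemma greedy_meanS u f : greedy_mean u.+1 f =
  greedy_mean u (fun G => let q := (1 - #|` G|%:R / u.+1%:R) ^+ m in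
    (1 - q) * f G + q * f (u.+2 |` G)%fset).
Proof.
rewrite /greedy_mean /= big_cat big_map /= -big_split /=.
apply: eq_big_seq => G GL.
have mA := measurable_greedy_event GL.
have mE := measurable_select_in u.+2 (~` [set` G]).
rewrite greedy_event_stay// greedy_event_grow// fine_probabilityD//.
rewrite greedy_event_select// probability_avoid//; ring.
Qed.

Lemma ler_greedy_mean u f g : (forall G, G \in greedy_values u -> f G <= g G) ->
  greedy_mean u f <= greedy_mean u g.
Proof.
move=> fg; rewrite /greedy_mean !big_seq; apply: ler_sum => G GL.
by apply: ler_wpM2l; [exact: fine_ge0|exact: fg].
Qed.

(** The weights [1 - q] and [q] add up to 1, so total mass is preserved from the deterministic
    start. *)
Lemma greedy_mean_cst u (c : R) : greedy_mean u (fun=> c) = c.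
Proof.
elim: u => [|u IH]; last first.
  rewrite greedy_meanS -[RHS]IH; apply: eq_bigr => G _ /=; ring.
rewrite /greedy_mean big_seq1 (_ : greedy_event _ _ = setT).
  by rewrite probability_setT mul1r.
by apply/seteqP; split.
Qed.

(* The drift of [#|G| - w t] has the opposite sign to [#|G| - w t] itself, as
   [(1 - x) ^+ m] is decreasing with fixed point [w]; so each step adds at most
   the variance of one indicator to the second moment. *)
Lemma second_moment (w : R) u : 0 < w < 1 -> (1 - w) ^+ m = w ->
  greedy_mean u (fun G => (#|` G|%:R - w * u.+1%:R) ^+ 2) <= u.+1%:R.
Proof.
move=> /andP[w0 w1] wE; elim: u => [|u IH].
  rewrite -[leRHS](greedy_mean_cst 0); apply: ler_greedy_mean => G.
  rewrite inE => /eqP ->; rewrite cardfs1; nra.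
rewrite greedy_meanS -[leRHS]natr1.
apply: (@le_trans _ _ (greedy_mean u (fun G => (#|` G|%:R - w * u.+1%:R) ^+ 2)
                       + greedy_mean u (fun=> 1))); last first.
  by rewrite greedy_mean_cst lerD2r.
rewrite /greedy_mean -big_split/=; under [leRHS]eq_bigr do rewrite -mulrDr.
apply: ler_greedy_mean => G GL.
rewrite cardfsU1 (greedy_values_fresh GL) add1n -[#|` G|.+1%:R]nat1r -[u.+2%:R]natr1.
have := greedy_values_card GL; rewrite -(ler_nat R).
have : (0 : R) <= #|` G|%:R by [].
have : (0 : R) < u.+1%:R by rewrite ltr0n.
move: (#|` G|%:R : R) (u.+1%:R : R) => x t t0 x0 xt.
have xt1 : 0 <= x / t <= 1 by rewrite divr_ge0 ?(ltW t0)//= ler_pdivrMr ?mul1r.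
set q := (1 - x / t) ^+ m.
have q0 : 0 <= q by rewrite exprn_ge0; lra.
have q1 : q <= 1 by rewrite exprn_ile1; lra.
have drift : (x - w * t) * (q - w) <= 0.
  have [wx|xw] := leP (w * t) x.
    rewrite mulr_ge0_le0 ?subr_ge0// subr_le0 -[leRHS]wE.
    have : w <= x / t by rewrite ler_pdivlMr.
    by move=> ?; apply: lerXn2r; rewrite ?nnegrE; lra.
  rewrite mulr_le0_ge0//; first lra.
  rewrite subr_ge0 -[leLHS]wE.
  have : x / t < w by rewrite ltr_pdivrMr.
  by move=> ?; apply: lerXn2r; rewrite ?nnegrE; lra.
have v1 : (1 - q) * w ^+ 2 + q * (1 - w) ^+ 2 <= 1.
  apply: (@le_trans _ _ ((1 - q) * 1 + q * 1)); last by rewrite !mulr1 subrK.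
  by apply: lerD; apply: ler_wpM2l; rewrite ?exprn_ile1//; lra.
(* Expansion of the mean square after one step: the increment is an indicator of mean [q] minus [w],
   and [v1] bounds its second moment. *)
rewrite (_ : _ + _ = (x - w * t) ^+ 2 + 2 * ((x - w * t) * (q - w)) +
    ((1 - q) * w ^+ 2 + q * (1 - w) ^+ 2)); last by ring.
lra.
Qed.

(** * Chebyshev's inequality for the deviation *)

(** A finite union of greedy events, so measurability and the Chebyshev bound can both be obtained
    by induction on the list of values. *)
Definition greedy_far (w c : R) u : set T :=
  \big[setU/set0]_(G <- greedy_values u | c < `|#|` G|%:R - w * u.+1%:R|)
    greedy_event u G.

Lemma greedy_farP w c u x :
  c < `|#|` greedy_indep (fun v j => sel v j x) u.+1|%:R - w * u.+1%:R| ->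
  greedy_far w c u x.
Proof.
move=> h; rewrite /greedy_far -bigcup_seq_cond.
exists (greedy_indep (fun v j => sel v j x) u.+1) => //=.
by rewrite mem_greedy_values h.
Qed.

(** Chebyshev: each [G] in the union has squared deviation at least [c ^+ 2], and subadditivity
    compares the union with the corresponding terms of the second moment. *)
Lemma greedy_far_le w c u : 0 < w < 1 -> (1 - w) ^+ m = w -> 0 < c ->
  measurable (greedy_far w c u) /\ pr (greedy_far w c u) <= u.+1%:R / c ^+ 2.
Proof.
move=> w01 wE c0; rewrite ler_pdivlMr ?exprn_gt0//.
suff: measurable (greedy_far w c u) /\ pr (greedy_far w c u) * c ^+ 2 <=
    greedy_mean u (fun G => (#|` G|%:R - w * u.+1%:R) ^+ 2).
  by move=> [? h]; split=> //; apply: le_trans h _; exact: second_moment.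
rewrite /greedy_far /greedy_mean.
(* The list is generalized to a part of [greedy_values u]; the inclusion keeps every event
   measurable along the induction. *)
have : {subset greedy_values u <= greedy_values u} by [].
elim: {1 3 4 5}(greedy_values u) => [|G s IH] sub.
  by rewrite !big_nil measure0 mul0r.
have GL : G \in greedy_values u by apply: sub; rewrite mem_head.
have {}IH := IH (fun H Hs => sub H (mem_behead (s := G :: s) Hs)).
have mA := measurable_greedy_event GL.
have pA : 0 <= pr (greedy_event u G) by exact: fine_ge0.
rewrite !big_cons; case: ifPn => [far|_]; last first.
  by case: IH => ? IH; split=> //; rewrite (le_trans IH)// lerDr mulr_ge0 ?sqr_ge0.
case: IH => mU IH; split; first exact: measurableU.
apply: (@le_trans _ _ ((pr (greedy_event u G) + pr (\big[setU/set0]_(j <- s | c < `|#|` j|%:R - w * u.+1%:R|) greedy_event u j)) * c ^+ 2)).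
  rewrite ler_wpM2r ?sqr_ge0// -fineD ?fin_num_measure//.
  apply: fine_le; rewrite ?fin_numD ?fin_num_measure//; first exact: measurableU.
  exact: measureU2.
rewrite mulrDl lerD// ler_wpM2l// -[leRHS]real_normK ?num_real//.
by rewrite lerXn2r ?nnegrE// ltW.
Qed.

End greedy_law.

(** * Almost sure convergence by Borel-Cantelli along the cubes *)

Theorem theorem2p11 (R : realType) (m : nat) (hm : (1 <= m)%N)
    (d : measure_display) (T : measurableType d) (P : probability T R)
    (sel : nat -> 'I_m -> {RV P >-> nat}) (hsel : uniform_attachment sel) :
  exists w : R,
    unique (fun x : R => 0 < x < 1 /\ - x + (1 - x) ^+ m = 0) w /\
    forall alpha : R, alpha < 1 / 3 ->
      {ae P, forall omega : T,
        (fun t : nat =>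
           t%:R `^ alpha *
           `| #|` greedy_indep (fun v j => sel v j omega) t|%:R / t%:R - w |)
          @ \oo --> (0 : R)}.
Proof.
have [w wU] := fixpoint_decreasing_power R hm; exists w; split=> // alpha a3.
have [[w01 w0] _] := wU; have wE : (1 - w) ^+ m = w by lra.
pose del := 1 - 3 * alpha; have d0 : 0 < del by rewrite /del; lra.
(* Any smaller power than [2 + del = 3 * (1 - alpha)] is negligible at the cubes, and any power
   above 2 makes the Chebyshev bounds summable; this is the midpoint. *)
pose c k : R := k.+1%:R `^ (2 + del / 2).
(* The predecessor appears because [greedy_far] at index [u] concerns time [u.+1]. *)
pose F k := greedy_far sel w (c k) (k.+1 ^ 3).-1.
have cube k : (k.+1 ^ 3).-1.+1 = (k.+1 ^ 3)%N by rewrite prednK// expn_gt0.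
have FP k : measurable (F k) /\ fine (P (F k)) <= k.+1%:R `^ (- (1 + del)).
  have k0 : (0 : R) < k.+1%:R by rewrite ltr0n.
  have [|mF PF] := greedy_far_le (c := c k) hsel (k.+1 ^ 3).-1 w01 wE.
    by rewrite powR_gt0.
  split=> //; apply: le_trans PF _.
  rewrite cube /c natrX -!powR_mulrn ?powR_ge0 ?(ltW k0)//.
  rewrite -powRrM -powRN -powRD ?(gt_eqF k0) ?implybT//.
  by apply: ler_powR; rewrite ?ler1n//; lra.
(* The exceptional set consists of the points in infinitely many [F k], null by Borel-Cantelli. *)
exists (lim_sup_set F); split.
- apply: bigcapT_measurable => n; apply: bigcup_measurable => k _.
  by have [] := FP k.
- apply: lim_sup_set_cvg0 => [k|]; first by have [] := FP k.
  apply: (@le_lt_trans _ _ (1 + del^-1)%:E); last exact: ltry.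
  apply: lime_le; first exact: is_cvg_nneseries.
  apply: nearW => n; apply: le_trans (_ : (_ <= (\sum_(0 <= k < n) k.+1%:R `^ (- (1 + del)))%:E)%E) _.
    rewrite -sumEFin; apply: lee_sum => k _.
    by have [mF] := FP k; rewrite -lee_fin -fine_probability.
  by rewrite lee_fin sum_powRN_le.
- move=> x /= xN; apply: contrapT => xF; apply: xN.
  have [N hN] : exists N, forall k, (N <= k)%N -> ~ F k x.
    apply: contrapT => h; apply: xF => n _; apply: contrapT => h'.
    by apply: h; exists n => k nk Fk; apply: h'; exists k.
  pose Y t : R := #|` greedy_indep (fun v j => sel v j x) t|%:R - w * t%:R.
  have YN k : (N <= k)%N -> `|Y (k.+1 ^ 3)%N| <= c k.
    move=> /hN nF; rewrite leNgt; apply/negP => h; apply: nF.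
    by apply: greedy_farP; rewrite cube.
  have Y1 t : (1 <= t)%N -> `|Y t.+1 - Y t| <= 1.
    exact: greedy_dist_lipschitz.
  (* The two sequences are identified only for [t >= 1], where division by [t] is genuine. *)
  apply: cvg_trans (cube_interpolation a3 Y1 YN); apply: near_eq_cvg.
  near=> t; have t0 : (0 : R) < t%:R by rewrite ltr0n; near: t; exists 1%N.
  rewrite -{2}(gtr0_norm t0) -normf_div.
  by congr (_ * `|_|); rewrite /Y; field; rewrite gt_eqF.
Unshelve. all: by end_near.
Qed.
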